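(* Let $p\in[0,1)$. Assume that for a Borel probability measure $\nu$ on $\mathcal F$ and a function $\Psi\in\mathcal F$ we have $$M^\Psi_n(\lambda)=\int_{\mathcal F}M^\Phi_n(\lambda)\,\nu(d\Phi)$$ for all $n\ge 0$ and all $\lambda\in\mathbb G^p_n$. Then $\nu$ is the Dirac measure $\delta_\Psi$ concentrated at $\Psi$.
   Context: $\mathbb G^p_n$ is the set of partitions $\lambda=(\lambda_1\ge\dots\ge\lambda_n\ge 0)$ with at most $n$ nonzero parts ($\mathbb G^p_0=\{\varnothing\}$). For $\lambda\in\mathbb G^p_n$, $$G_\lambda^{(0,-p)}(x_1,\dots,x_n)=\frac{\det\left[x_i^{\lambda_j+n-j}(1-p x_i)^{j-1}\right]_{1\le i,j\le n}}{\det\left[x_i^{n-j}\right]_{1\le i,j\le n}},$$ and $1^n$ means that all $n$ variables equal $1$. Let $\overline{\mathbb D}=\{z\in\mathbb C:|z|\le 1\}$. $\mathcal F$ is the set of complex functions $\Phi$ on $\overline{\mathbb D}$ which are uniform limits on $\overline{\mathbb D}$ of sequences of rational functions of the form $\Phi_k(z)=\prod_{i=1}^{n_k}\frac{1-x_{i,k}(z-1)}{1-y_{i,k}(z-1)}$ with $x_{i,k}\in[-1,\frac{p}{1-p}]$, $y_{i,k}\ge 0$, $y_{i,k}\ge x_{i,k}$. $\mathcal F$ is equipped with the topology of uniform convergence on $\overline{\mathbb D}$ and the corresponding Borel $\sigma$-algebra. For $\Phi\in\mathcal F$ the numbers $M_n^\Phi(\lambda)$ are defined by $M_0^\Phi(\varnothing)=1$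 and, for $n\ge1$, by the identity of formal power series in $z_1,\dots,z_n$ (with $\Phi$ expanded in Taylor series at $0$) $$\sum_{\lambda\in\mathbb G^p_n}M_n^\Phi(\lambda)\frac{G_\lambda^{(0,-p)}(z_1,\dots,z_n)}{G_\lambda^{(0,-p)}(1^n)}=\Phi(z_1)\cdots\Phi(z_n).$$ *)

(* Defs.v *)
From HB Require Import structures.
From mathcomp Require Import all_boot all_order all_algebra.
From mathcomp Require Import all_classical all_reals all_analysis.
From mathcomp Require Import complex.
(* The notations of mpoly clash with those of MathComp-Analysis. *)
From mathcomp Require Import -(notations) mpoly.

Set Implicit Arguments.
Unset Strict Implicit.
Unset Printing Implicit Defensive.

Import Order.TTheory GRing.Theory Num.Theory numFieldNormedType.Exports.

Local Open Scope classical_set_scope.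
Local Open Scope ring_scope.
Local Open Scope complex_scope.

(* Partitions with at most n nonzero parts, padded with zeros to length n. *)
Definition part (n : nat) := {l : n.-tuple nat | sorted geq l}.

HB.instance Definition _ n := Choice.on (part n).

Definition part_nth n (l : part n) (j : 'I_n) : nat := tnth (val l) j.

Section Grothendieck.
Variables (R : realType) (p : R) (n : nat).

Definition mvar (i : 'I_n) : mpoly n R[i] := mpolyX R[i] (mnm1 i).

(* Columns are indexed from 0, so j here is j - 1 in the usual formulas. *)
Definition groth_num (l : part n) : mpoly n R[i] :=
  \det (\matrix_(i < n, j < n)
    (mvar i ^+ (part_nth l j + (n - j.+1)) *
     (1 - mpolyC n p%:C * mvar i) ^+ j)).

Definition groth_den : mpoly n R[i] :=
  \det (\matrix_(i < n, j < n) mvar i ^+ (n - j.+1)).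

(* The ratio of the two determinants is a polynomial: the quotient is taken in
   the polynomial ring, so that it can be evaluated at points with coinciding
   coordinates. It is unique because groth_den is nonzero. *)
Definition groth (l : part n) : mpoly n R[i] :=
  xget 0 [set q | q * groth_den = groth_num l].

(* The value at 1^n. *)
Definition groth1 (l : part n) : R[i] := meval (fun=> 1) (groth l).

End Grothendieck.

Definition disk (R : realType) := {z : R[i] | `|z| <= 1}.

HB.instance Definition _ R := Choice.on (disk R).

(* R[i]^o is R[i] seen as a normed module, hence a uniform space. *)
Notation diskfun R := {uniform disk R -> R[i]^o}.

Section FunctionClass.
Variables (R : realType) (p : R).

Definition admissible (s : seq (R * R)) : Prop :=
  forall xy, xy \in s ->
    [/\ -1 <= xy.1 <= p / (1 - p), 0 <= xy.2 & xy.1 <= xy.2].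

Definition ratfun (s : seq (R * R)) : diskfun R :=
  fun z => \prod_(xy <- s)
    ((1 - xy.1%:C * (val z - 1)) / (1 - xy.2%:C * (val z - 1))).

Definition calF : set (diskfun R) :=
  [set Phi | exists s : nat -> seq (R * R),
    (forall k, admissible (s k)) /\ ratfun (s k) @[k --> \oo] --> Phi].

Lemma calF1 : calF (ratfun [::]).
Proof. by exists (fun=> [::]); split=> //; exact: cvg_cst. Qed.

Definition Fspace : Type := set_type calF.

(* The trace on calF of the topology of uniform convergence. *)
HB.instance Definition _ := Topological.copy Fspace (set_type calF).
HB.instance Definition _ :=
  isPointed.Build Fspace (exist _ (ratfun [::]) (mem_set calF1)).

Definition Ffun (Phi : Fspace) : disk R -> R[i] := set_val Phi.

End FunctionClass.

Notation Fborel p := (g_sigma_algebraType (@open (Fspace p))).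

Section Coefficients.
Variable R : realType.

(* Extension by 0, needed because derive1n takes total functions; 0 is interior
   to the disk, so the derivatives there do not depend on the extension. *)
Definition ext0 (f : disk R -> R[i]) (z : R[i]) : R[i]^o :=
  oapp f 0 (insub z).

Definition taylor_coef (f : disk R -> R[i]) (k : nat) : R[i] :=
  derive1n k (ext0 f) 0 / (k`!)%:R.

(* Identity of formal power series, coefficient by coefficient. The sum over
   partitions is finitely supported: every monomial of groth p l has degree
   at least the size of l. *)
Definition is_expansion (p : R) (f : disk R -> R[i]) n (M : part n -> R[i]) :=
  forall m : multinom n,
    \sum_(l \in [set: part n]) (M l * (mcoeff m (groth p l) / groth1 p l)) =
    \prod_(i < n) taylor_coef f (m i).

Definition Mnum (p : R) (f : disk R -> R[i]) (n : nat) : part n -> R[i] :=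
  match n return part n -> R[i] with
  | 0 => fun=> 1
  | n'.+1 => xget (fun=> 0) [set M : part n'.+1 -> R[i] | is_expansion p f M]
  end.

End Coefficients.

(* Integral of a complex-valued function. *)
Definition Cintegral d (T : measurableType d) (R : realType)
    (mu : {measure set T -> \bar R}) (f : T -> R[i]) : R[i] :=
  (\int[mu]_x complex.Re (f x)) +i* (\int[mu]_x complex.Im (f x)).

(* Main.v *)
Require Import Defs.
From mathcomp Require Import all_boot all_order all_algebra.
From mathcomp Require Import all_classical all_reals all_analysis.
From mathcomp Require Import measurable_realfun.
From mathcomp Require Import complex ring lra zify.
From mathcomp Require Import -(notations) mpoly.

(** The levels n = 1 and n = 2 of the system of numbers M_n determine nu.

    Let c_k be the k-th Taylor coefficient of a function Phi of the class.
    In one variable G_(k) = z^k, so M_1(k) = c_k.  In two variables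
    G_(a,b) = s_(a,b) - p s_(a,b+1), so the expansion of Phi(x) Phi(y) is a
    triangular system for M_2, with the solution

      M_2(a,b) = G_(a,b)(1,1) m_(a,b),
      m_(a,b) = p m_(a,b-1) + c_a c_b - c_(a+1) c_(b-1).

    Since G_(a,b)(1,1) = (a-b+1) - p (a-b) is positive for p < 1, every
    c_a c_b is a fixed finite linear combination of values of M_2.  Hence the
    hypothesis says in particular that, under nu, c_k has mean c_k(Psi) and
    c_k^2 has mean c_k(Psi)^2 (lemmas mean_at_coef and mean_at_coefM): the
    variance of c_k is zero, and c_k = c_k(Psi) almost surely, for all k
    simultaneously.  A function of the class is determined by its Taylor
    coefficients (calF_taylor_inj), so Phi = Psi almost surely.

    The analytic input is that all the c_k lie in [0,1] and are Borel.  Each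
    factor (1 - x(z-1)) / (1 - y(z-1)) is a power series with nonnegative
    coefficients of sum at most 1, and so are the finite products; along an
    ultrafilter the coefficients of a uniformly convergent sequence of such
    products converge (calF_series).  The bound c_k <= 1 makes the remainder
    of the series explicit.  It replaces Cauchy's estimates: c_k is the limit,
    as t = 1/(n+2) tends to 0, of t^(-k) (Phi(t) - sum_(j<k) c_j t^j), which
    gives measurability by induction on k.  The derivatives that define the
    Taylor coefficients are computed by differentiating the series term by
    term (derive1n_expands), and the values on the unit circle are radial
    limits of the values inside. *)

Set Implicit Arguments.
Unset Strict Implicit.
Unset Printing Implicit Defensive.

Import Order.TTheory GRing.Theory Num.Theory numFieldNormedType.Exports.

Local Open Scope classical_set_scope.
Local Open Scope ring_scope.
Local Open Scope complex_scope.

(** * The complex modulus as a real number *)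

Notation cnorm := Normc.normc.

Section ComplexNorm.
Variable R : realType.
Implicit Types (x y z w : R[i]) (e : R).

Lemma cnormE z : `|z| = (cnorm z)%:C.
Proof. by case: z. Qed.

Lemma cnorm_ge0 z : 0 <= cnorm z.
Proof. by rewrite -lecR -cnormE normr_ge0. Qed.

Lemma cnorm_real e : cnorm e%:C = `|e|.
Proof. by rewrite /= expr0n addr0 sqrtr_sqr. Qed.

Lemma cnorm_nat n : cnorm (n%:R : R[i]) = n%:R.
Proof. by rewrite -(rmorph_nat (real_complex R)) cnorm_real normr_nat. Qed.

Lemma cnormX z n : cnorm (z ^+ n) = cnorm z ^+ n.
Proof.
by elim: n => [|n IHn]; rewrite ?expr0 ?Normc.normc1// !exprS Normc.normcM IHn.
Qed.

Lemma cnormBC z w : cnorm (z - w) = cnorm (w - z).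
Proof. by rewrite -normcN opprB. Qed.

Lemma cnorm_sum (I : Type) (s : seq I) (P : pred I) (F : I -> R[i]) :
  cnorm (\sum_(i <- s | P i) F i) <= \sum_(i <- s | P i) cnorm (F i).
Proof.
elim/big_ind2: _ => [|a x b y ax by_|//]; first by rewrite Normc.normc0.
exact: le_trans (le_normcD _ _) (lerD _ _).
Qed.

Lemma cnorm_Re z : `|complex.Re z| <= cnorm z.
Proof. by rewrite -lecR -cnormE; exact: normc_ge_Re. Qed.

Lemma cnorm_Im z : `|complex.Im z| <= cnorm z.
Proof.
case: z => a b /=; rewrite -sqrtr_sqr ler_sqrt ?addr_ge0 ?sqr_ge0//.
by rewrite lerDr sqr_ge0.
Qed.

Lemma cnorm_le_ReIm z : cnorm z <= `|complex.Re z| + `|complex.Im z|.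
Proof.
case: z => a b /=; rewrite -(@ler_pXn2r _ 2) ?nnegrE ?sqrtr_ge0 ?addr_ge0//.
rewrite sqr_sqrtr ?addr_ge0 ?sqr_ge0// sqrrD -!normrX.
rewrite (ger0_norm (sqr_ge0 a)) (ger0_norm (sqr_ge0 b)).
have := mulr_ge0 (normr_ge0 a) (normr_ge0 b); lra.
Qed.

(** Positive elements of the ordered field of complex numbers are real, so
    convergence can be tested with real radii, where linear arithmetic
    applies. *)
Lemma cvg_cnormP (T : Type) (F : set_system T) {FF : Filter F}
    (f : T -> R[i]^o) (l : R[i]^o) :
  f @ F --> l <-> forall e, 0 < e -> \forall t \near F, cnorm (l - f t) < e.
Proof.
split=> [/cvgrPdist_lt fl e e0|fl].
  have : 0 < e%:C by rewrite ltcR.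
  by move=> /fl; apply: filterS => t; rewrite cnormE ltcR.
apply/cvgrPdist_lt => -[e e']; rewrite ltcE/= => /andP[/eqP -> /fl].
by apply: filterS => t; rewrite cnormE -[_ +i* _]/(_%:C) ltcR.
Qed.

Lemma cvg_cnorm (T : Type) (F : set_system T) {FF : Filter F}
    (f : T -> R[i]^o) (l : R[i]^o) :
  f @ F --> l -> (fun t => cnorm (f t)) @ F --> (cnorm l : R^o).
Proof.
move=> /cvg_cnormP fl; apply/cvgrPdist_lt => e /fl; apply: filterS => t.
apply: le_lt_trans; rewrite ler_norml.
have := le_normcD (f t) (l - f t); have := le_normcD l (f t - l).
by rewrite !(addrC _ (_ - _)) !subrK (cnormBC (f t)) => *; lra.
Qed.

Lemma cvg_ReIm (T : Type) (F : set_system T) {FF : Filter F}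
    (f : T -> R[i]^o) (l : R[i]^o) :
  (fun t => complex.Re (f t)) @ F --> (complex.Re l : R^o) ->
  (fun t => complex.Im (f t)) @ F --> (complex.Im l : R^o) -> f @ F --> l.
Proof.
move=> /cvgrPdist_lt fR /cvgrPdist_lt fI; apply/cvg_cnormP => e e0.
have e20 : 0 < e / 2 by rewrite divr_gt0.
near=> t; apply: le_lt_trans (cnorm_le_ReIm _) _.
rewrite [e]splitr ltrD//.
  by rewrite (raddfB (@complex.Re R)); near: t; exact: fR.
by rewrite (raddfB (@complex.Im R)); near: t; exact: fI.
Unshelve. all: by end_near.
Qed.

Lemma cvg_Re (T : Type) (F : set_system T) {FF : Filter F}
    (f : T -> R[i]^o) (l : R[i]^o) :
  f @ F --> l -> (fun t => complex.Re (f t)) @ F --> (complex.Re l : R^o).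
Proof.
move=> /cvg_cnormP fl; apply/cvgrPdist_lt => e /fl; apply: filterS => t.
by apply: le_lt_trans; rewrite -(raddfB (@complex.Re R)) cnorm_Re.
Qed.

End ComplexNorm.

(** * Termwise differentiation of complex power series *)

Section PowerSeries.
Variable R : realType.
Implicit Types (a : nat -> R[i]) (z h : R[i]) (r : R) (F : R[i] -> R[i]^o).

(** The sum is stated as a limit of partial sums, because F is given first
    and its coefficients are found afterwards. *)
Definition expands a F := forall z, cnorm z < 1 ->
  (fun N => \sum_(n < N) a n * z ^+ n : R[i]^o) @ \oo --> F z.

(** Radius of convergence at least 1, phrased by bounds on the terms because
    in this form it passes to the termwise derivative at once. *)
Definition tame a := forall r, 0 < r < 1 ->
  exists B, forall n, cnorm (a n) * r ^+ n <= B.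

(** Multiplying the coefficients by n costs only an arbitrarily small part of
    the radius; this bound is what makes [tame] stable under derivation. *)
Lemma mulrn_expr_le r n : 0 < r < 1 -> n%:R * r ^+ n <= r / (1 - r).
Proof.
move=> /andP[r0 r1]; have d0 : 0 < 1 - r by rewrite subr_gt0.
rewrite ler_pdivlMr//; elim: n => [|n IHn].
  by rewrite mul0r mul0r ltW.
have rn : r ^+ n.+1 <= r by rewrite -[leRHS]expr1 ler_wiXn2l// ltW.
have -> : n.+1%:R * r ^+ n.+1 * (1 - r) =
   r * (n%:R * r ^+ n * (1 - r)) + r ^+ n.+1 * (1 - r).
  by rewrite exprS -natr1; ring.
apply: le_trans (lerD (ler_wpM2l (ltW r0) IHn) (ler_wpM2r (ltW d0) rn)) _.
lra.
Qed.

Lemma tame_natmul a : tame a -> tame (fun n => n%:R * a n).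
Proof.
move=> ta r /andP[r0 r1].
(* Any radius strictly between r and 1 serves. *)
pose s := (1 + r) / 2.
have s01 : 0 < s < 1 by rewrite /s; apply/andP; split; lra.
have [s0 s1] := andP s01.
have rs : 0 < r / s < 1.
  by rewrite divr_gt0//= ltr_pdivrMr// mul1r /s; lra.
have [B aB] := ta _ s01; exists (B * (r / s / (1 - r / s))) => n.
have -> : cnorm (n%:R * a n) * r ^+ n =
    cnorm (a n) * s ^+ n * (n%:R * (r / s) ^+ n).
  rewrite Normc.normcM cnorm_nat (expr_div_n r s).
  have : s ^+ n != 0 by rewrite expf_neq0// gt_eqF.
  by move: (s ^+ n) (r ^+ n) => t u t0; field.
have [rs0 rs1] := andP rs.
apply: ler_pM => //; last exact: mulrn_expr_le.
- by rewrite mulr_ge0 ?cnorm_ge0 ?exprn_ge0 ?ltW.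
- by rewrite mulr_ge0// exprn_ge0 ?ltW.
Qed.

Lemma tame_shift a : tame a -> tame (fun n => a n.+1).
Proof.
move=> ta r r01; have [r0 r1] := andP r01; have [B aB] := ta _ r01.
exists (B / r) => n; rewrite ler_pdivlMr// -mulrA -exprSr; exact: aB.
Qed.

Lemma tame_sum a r : tame a -> 0 < r < 1 ->
  exists B, forall N, \sum_(n < N) cnorm (a n) * r ^+ n <= B.
Proof.
move=> ta /andP[r0 r1]; pose s := (1 + r) / 2.
have s01 : 0 < s < 1 by rewrite /s; apply/andP; split; lra.
have [s0 s1] := andP s01; have [B aB] := ta _ s01.
have B0 : 0 <= B by apply: le_trans (aB 0%N); rewrite mulr1 cnorm_ge0.
have q0 : 0 < r / s by rewrite divr_gt0.
have q1 : r / s < 1 by rewrite ltr_pdivrMr// mul1r /s; lra.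
exists (B * (1 - r / s)^-1) => N.
apply: (@le_trans _ _ (\sum_(n < N) B * (r / s) ^+ n)).
  apply: ler_sum => n _; rewrite (expr_div_n r s) mulrA ler_pdivlMr ?exprn_gt0//.
  by rewrite mulrAC ler_wpM2r ?exprn_ge0 ?(ltW r0).
rewrite -mulr_sumr ler_wpM2l//.
have := subrX1 (r / s) N; set S := \sum_(_ < _) _ => E.
have -> : S = (1 - (r / s) ^+ N) / (1 - r / s).
  apply: (@mulIf _ (1 - r / s)); first by rewrite subr_eq0 eq_sym lt_eqF.
  rewrite divfK ?subr_eq0 1?eq_sym ?lt_eqF//.
  rewrite -[1 - r / s]opprB -[1 - _ ^+ _]opprB E; ring.
rewrite ler_pdivrMr ?subr_gt0// mulVf ?subr_eq0 1?eq_sym ?lt_eqF//.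
by rewrite gerBl exprn_ge0 ?ltW.
Qed.

Lemma bounded_series_cvg (u : nat -> R) (B : R) :
  (forall N, \sum_(n < N) `|u n| <= B) ->
  exists l : R, (fun N => \sum_(n < N) u n) @ \oo --> l.
Proof.
move=> uB; have : cvgn (series u).
  apply: (@normed_cvg R R^o); apply: nondecreasing_is_cvgn.
    by apply: nondecreasing_series => n _ _; exact: normr_ge0.
  exists B => _ [N _ <-] /=; rewrite /series/= big_mkord; exact: uB.
move=> /cvg_ex[l ul]; exists l.
rewrite (_ : (fun N => _) = series u)//.
by apply/funext => N; rewrite /series/= big_mkord.
Qed.

Lemma tame_cvg a z : tame a -> cnorm z < 1 ->
  exists l : R[i]^o, (fun N => \sum_(n < N) a n * z ^+ n : R[i]^o) @ \oo --> l.
Proof.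
move=> ta z1; pose r := (1 + cnorm z) / 2.
have z0 := cnorm_ge0 z.
have zr : cnorm z <= r by rewrite /r; lra.
have r01 : 0 < r < 1 by rewrite /r; apply/andP; split; lra.
have [B aB] := tame_sum ta r01.
have bnd n : cnorm (a n * z ^+ n) <= cnorm (a n) * r ^+ n.
  rewrite Normc.normcM cnormX ler_wpM2l ?cnorm_ge0// lerXn2r// nnegrE//.
  by case/andP: r01 => /ltW.
have [|l1 R1] := @bounded_series_cvg (fun n => complex.Re (a n * z ^+ n)) B.
  move=> N; apply: le_trans (aB N); apply: ler_sum => n _.
  exact: le_trans (cnorm_Re _) (bnd _).
have [|l2 I2] := @bounded_series_cvg (fun n => complex.Im (a n * z ^+ n)) B.
  move=> N; apply: le_trans (aB N); apply: ler_sum => n _.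
  exact: le_trans (cnorm_Im _) (bnd _).
exists (l1 +i* l2); apply: cvg_ReIm => /=.
  by under eq_fun do rewrite (raddf_sum (@complex.Re R)).
by under eq_fun do rewrite (raddf_sum (@complex.Im R)).
Qed.

(** Second order Taylor bound for the monomials, multiplied by r^2 so that the
    exponent n - 2 does not occur. *)
Lemma expr_taylor2 z h r n : cnorm z <= r -> cnorm (z + h) <= r ->
  r ^+ 2 * cnorm ((z + h) ^+ n - z ^+ n - n%:R * (h * z ^+ n.-1)) <=
  cnorm h ^+ 2 * (n%:R * (n%:R * r ^+ n)).
Proof.
move=> zr zhr; have r0 : 0 <= r := le_trans (cnorm_ge0 z) zr.
have h0 : 0 <= cnorm h ^+ 2 by rewrite exprn_ge0 ?cnorm_ge0.
elim: n => [|n IHn].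
  by rewrite !expr0 subrr sub0r !mul0r oppr0 Normc.normc0 !mulr0.
have -> : (z + h) ^+ n.+1 - z ^+ n.+1 - n.+1%:R * (h * z ^+ n.+1.-1) =
    (z + h) * ((z + h) ^+ n - z ^+ n - n%:R * (h * z ^+ n.-1)) +
    n%:R * h ^+ 2 * z ^+ n.-1.
  case: n {IHn} => [|n] /=; first by rewrite !expr1 !expr0; ring.
  by rewrite !exprS -!natr1; ring.
apply: (@le_trans _ _ (r * (cnorm h ^+ 2 * (n%:R * (n%:R * r ^+ n))) +
    cnorm h ^+ 2 * (n%:R * r ^+ n.+1))).
  apply: (@le_trans _ _ (r ^+ 2 * (cnorm (z + h) *
      cnorm ((z + h) ^+ n - z ^+ n - n%:R * (h * z ^+ n.-1)) +
      n%:R * cnorm h ^+ 2 * cnorm z ^+ n.-1))).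
    rewrite ler_wpM2l ?exprn_ge0//; apply: le_trans (le_normcD _ _) _.
    by rewrite !Normc.normcM !cnormX cnorm_nat.
  rewrite mulrDr lerD//.
    rewrite mulrCA ler_pM ?cnorm_ge0 ?mulr_ge0 ?exprn_ge0 ?cnorm_ge0//.
  case: n {IHn} => [|n] /=; first by rewrite !mul0r !mulr0.
  have : cnorm z ^+ n <= r ^+ n by rewrite lerXn2r// nnegrE ?cnorm_ge0.
  move=> zn; rewrite (_ : r ^+ 2 * _ =
      cnorm h ^+ 2 * (n.+1%:R * (r ^+ 2 * cnorm z ^+ n))); last by ring.
  rewrite ler_wpM2l// ler_wpM2l// -(add2n n) exprD.
  by rewrite ler_wpM2l ?exprn_ge0.
have rn : 0 <= n%:R * (cnorm h ^+ 2 * r ^+ n.+1) 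
  by rewrite mulr_ge0// mulr_ge0// exprn_ge0.
have rn' : 0 <= cnorm h ^+ 2 * r ^+ n.+1 by rewrite mulr_ge0// exprn_ge0.
rewrite -subr_ge0 (_ : _ - _ = n%:R * (cnorm h ^+ 2 * r ^+ n.+1) +
  cnorm h ^+ 2 * r ^+ n.+1); first exact: addr_ge0.
by rewrite -natr1 !exprS; ring.
Qed.

(** The monomial bounds are summable against a tame sequence, so the remainder
    is O(h^2) uniformly on the disk of radius r. *)
Lemma expands_taylor1 a F G r : tame a -> expands a F ->
    expands (fun n => n.+1%:R * a n.+1) G -> 0 < r < 1 ->
  exists K, forall z h, cnorm z <= r -> cnorm (z + h) <= r ->
  cnorm (F (z + h) - F z - h * G z) <= cnorm h ^+ 2 * K.
Proof.
move=> ta aF aG r01; have [r0 r1] := andP r01.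
have [B nB] := tame_sum (tame_natmul (tame_natmul ta)) r01.
exists (B / r ^+ 2) => z h zr zhr.
have z1 := le_lt_trans zr r1; have zh1 := le_lt_trans zhr r1.
have shift : forall x, cnorm x < 1 ->
    (fun N => \sum_(n < N.+1) a n * x ^+ n : R[i]^o) @ \oo --> F x.
  move=> x /aF; rewrite -(cvg_shiftS _) //.
have L := cvg_cnorm (cvgB (cvgB (shift _ zh1) (shift _ z1))
  (cvgZ (cvg_cst (h : R[i]^o)) (aG _ z1))).
apply: (cvgr_to_le (L _ _ _ _ _)); apply: nearW => N; rewrite !fctE.
have -> : \sum_(n < N) n.+1%:R * a n.+1 * z ^+ n =
    \sum_(n < N.+1) n%:R * a n * z ^+ n.-1.
  by rewrite big_ord_recl !mul0r add0r.
rewrite scaler_sumr -!sumrB mulrA ler_pdivlMr ?exprn_gt0//.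
apply: (@le_trans _ _ (\sum_(n < N.+1) cnorm h ^+ 2 *
   (cnorm (n%:R * (n%:R * a n)) * r ^+ n))); last first.
  by rewrite -mulr_sumr ler_wpM2l ?exprn_ge0 ?cnorm_ge0.
rewrite mulrC; apply: le_trans (ler_wpM2l _ (cnorm_sum _ _ _)) _.
  by rewrite exprn_ge0 ?ltW.
rewrite mulr_sumr; apply: ler_sum => n _.
rewrite (_ : _ - _ = a n *
  ((z + h) ^+ n - z ^+ n - n%:R * (h * z ^+ n.-1))); last first.
  by rewrite -[_ *: _]/(_ * _); ring.
rewrite !Normc.normcM mulrCA cnorm_nat.
apply: le_trans (ler_wpM2l (cnorm_ge0 _) (expr_taylor2 n zr zhr)) _.
by rewrite le_eqVlt; apply/orP; left; apply/eqP; ring.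
Qed.

Lemma expands_derive1 a F : tame a -> expands a F ->
  expands (fun n => n.+1%:R * a n.+1) (derive1 F).
Proof.
move=> ta aF.
have tb : tame (fun n => n.+1%:R * a n.+1) := tame_shift (tame_natmul ta).
have /choice [G aG] : forall z, exists l : R[i]^o, cnorm z < 1 ->
  (fun N => \sum_(n < N) n.+1%:R * a n.+1 * z ^+ n : R[i]^o) @ \oo --> l.
  move=> x; have [x1|x1] := ltP (cnorm x) 1; last by exists 0.
  by have [l] := tame_cvg tb x1; exists l.
move=> z z1; suff -> : derive1 F z = G z by exact: aG.
pose r := (1 + cnorm z) / 2; have z0 := cnorm_ge0 z.
have r01 : 0 < r < 1 by rewrite /r; apply/andP; split; lra.
have [K FK] := expands_taylor1 ta aF aG r01.
apply: cvg_lim => //; apply/cvg_cnormP => e e0.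
have d0 : 0 < (Num.min (r - cnorm z) (e / (`|K| + 1)))%:C.
  rewrite ltcR lt_min; apply/andP; split; first by rewrite /r; lra.
  by rewrite divr_gt0// ltr_wpDl.
near=> h.
have h0 : h != 0 by near: h; exact: nbhs_dnbhs_neq.
have : `|h| < (Num.min (r - cnorm z) (e / (`|K| + 1)))%:C.
  by near: h; exact: dnbhs0_lt.
rewrite cnormE ltcR lt_min => /andP[hr he].
have h0' : 0 < cnorm h.
  rewrite lt_neqAle cnorm_ge0 andbT eq_sym; apply: contra h0.
  by move=> /eqP/Normc.eq0_normc ->.
have zhr : cnorm (z + h) <= r by have := le_normcD z h; lra.
have := FK z h _ zhr; have zr : cnorm z <= r by rewrite /r; lra.
move=> /(_ zr).
rewrite -(@ltr_pM2l _ (cnorm h))// -Normc.normcM => Fh.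
rewrite -[_ *: _]/(_ * _) (addrC h) mulrBr mulVKf// cnormBC.
apply: le_lt_trans Fh _; rewrite expr2 -mulrA ltr_pM2l//.
apply: (@le_lt_trans _ _ (cnorm h * `|K|)).
  by rewrite ler_wpM2l ?ler_norm ?cnorm_ge0.
apply: (@le_lt_trans _ _ (cnorm h * (`|K| + 1))).
  by rewrite ler_wpM2l ?lerDl ?cnorm_ge0.
by rewrite -ltr_pdivlMr// ltr_wpDl.
Unshelve. all: by end_near.
Qed.

(** The derivative is replaced by the shifted series on the whole open disk,
    which allows the induction on k to run with the sequence a varying. *)
Lemma derive1n_expands a F k : tame a -> expands a F ->
  derive1n k F 0 = k`!%:R * a k.
Proof.
elim: k a F => [|k IHk] a F ta aF.
  rewrite fact0 mul1r; have /aF : cnorm (0 : R[i]) < 1 by rewrite Normc.normc0.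
  move=> /(cvg_lim _); rewrite /derive1n/= => <- //.
  apply: cvg_lim => //; apply: cvg_near_cst; exists 1%N => // -[//|N] _ /=.
  rewrite big_ord_recl expr0 mulr1 big1 ?addr0// => i _.
  by rewrite expr0n mulr0.
rewrite derive1Sn (IHk (fun n => n.+1%:R * a n.+1)).
- by rewrite factS natrM mulrA [k`!%:R * _]mulrC.
- exact: tame_shift (tame_natmul ta).
- exact: expands_derive1.
Qed.

End PowerSeries.

(** * Products of linear fractional generating functions *)

Section UnitCoefficients.
Variable R : realType.
Implicit Types (a b : nat -> R) (x y : R) (z : R[i]).

(** Coefficients of a sub-probability generating function. *)
Definition unit_coefs a :=
  (forall n, 0 <= a n) /\ (forall N, \sum_(n < N) a n <= 1).

Lemma unit_coefs_le1 a n : unit_coefs a -> a n <= 1.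
Proof.
move=> [a0 a1]; apply: le_trans (a1 n.+1).
by rewrite big_ord_recr/= lerDr sumr_ge0.
Qed.

Lemma cvg_cnorm_expr z : cnorm z < 1 -> (fun N => cnorm z ^+ N) @ \oo --> (0 : R).
Proof. by move=> z1; apply: cvg_expr; rewrite ger0_norm ?cnorm_ge0. Qed.

Lemma denominator_neq0 y z : 0 <= y -> cnorm z <= 1 ->
  1 - y%:C * (z - 1) != 0.
Proof.
move=> y0 z1; apply/eqP => /(congr1 (@complex.Re R)); apply/eqP.
have := cnorm_Re z; rewrite ler_norml => /andP[_ zR].
rewrite (raddfB (@complex.Re R)) gt_eqF//.
have {zR} := le_trans zR z1; case: z {z1} => u v /= u1; rewrite mul0r subr0.
by rewrite ltrBDr add0r (@le_lt_trans _ _ 0)// mulr_ge0_le0// subr_le0.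
Qed.

(** Coefficients of z F(z) / (1 - y(z-1)), for F with coefficients a: the
    recursion is the product with the denominator 1 + y - y z. *)
Fixpoint delay (y : R) (a : nat -> R) (n : nat) : R :=
  if n is n'.+1 then (y * delay y a n' + a n') / (1 + y) else 0.

Lemma delay_unit y a : 0 <= y -> unit_coefs a -> unit_coefs (delay y a).
Proof.
move=> y0 [a0 a1]; have y1 : 0 < 1 + y by rewrite ltr_wpDr.
split=> [|N].
  elim=> [//|n IHn] /=; rewrite divr_ge0 ?(ltW y1)// addr_ge0// mulr_ge0//.
elim: N => [|N IHN]; first by rewrite big_ord0.
rewrite big_ord_recl/= add0r -mulr_suml big_split/= -mulr_sumr.
rewrite ler_pdivrMr// mul1r addrC lerD ?a1//.
exact: ler_piMr.
Qed.

(** The recursion telescopes: a partial sum times the denominator is a partial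
    sum of z F(z) up to one boundary term. *)
Lemma delay_sum y a z N : 0 <= y ->
  (1 - y%:C * (z - 1)) * \sum_(n < N) (delay y a n)%:C * z ^+ n =
  z * \sum_(n < N) (a n)%:C * z ^+ n - (1 + y)%:C * (delay y a N)%:C * z ^+ N.
Proof.
move=> y0; have y1 : 1 + y != 0 by rewrite gt_eqF// ltr_wpDr.
elim: N => [|N IHN]; first by rewrite !big_ord0 !mulr0 mul0r subr0.
rewrite !big_ord_recr/= [LHS]mulrDr IHN -[in RHS]rmorphM/=.
have -> : (1 + y) * ((y * delay y a N + a N) / (1 + y)) =
  y * delay y a N + a N by rewrite mulrC divfK.
rewrite !rmorphD !rmorphM !rmorph1/= exprS; ring.
Qed.

Lemma expands_delay y a F : 0 <= y -> unit_coefs a ->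
  expands (fun n => (a n)%:C) F ->
  expands (fun n => (delay y a n)%:C) (fun z => z * F z / (1 - y%:C * (z - 1))).
Proof.
move=> y0 ua aF z z1; have d0 := denominator_neq0 y0 (ltW z1).
have du := delay_unit y0 ua.
have -> : (fun N => \sum_(n < N) (delay y a n)%:C * z ^+ n : R[i]^o) =
  (fun N => (1 - y%:C * (z - 1))^-1 *: (z *: (\sum_(n < N) (a n)%:C * z ^+ n) -
       (1 + y)%:C *: ((delay y a N)%:C * z ^+ N) : R[i]^o)).
  apply/funext => N; rewrite -![_ *: _]/(_ * _) [in RHS]mulrA -delay_sum// mulKf//.
cbv beta; rewrite (_ : z * F z / _ =
    (1 - y%:C * (z - 1))^-1 *: (z *: F z - (1 + y)%:C *: 0 : R[i]^o)); last first.
  by rewrite scaler0 subr0 mulrC.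
apply: cvgZ; first exact: cvg_cst.
apply: cvgB; first by apply: cvgZ; [exact: cvg_cst|exact: aF].
apply: cvgZ; first exact: cvg_cst.
apply/cvg_cnormP => e e0.
have /cvgrPdist_lt/(_ _ e0) := cvg_cnorm_expr z1.
apply: filterS => N; rewrite !sub0r normrN normcN.
rewrite ger0_norm ?exprn_ge0 ?cnorm_ge0//; apply: le_lt_trans.
rewrite Normc.normcM cnormX cnorm_real ger0_norm ?(proj1 du)//.
by rewrite ler_piMl ?exprn_ge0 ?cnorm_ge0// unit_coefs_le1.
Qed.

(** A factor (1 - x(z-1)) / (1 - y(z-1)) equals s + t z / (1 - y(z-1)) with
    s = (1+x)/(1+y) and t = (y-x)/(1+y).  For y >= 0 both weights are
    nonnegative exactly when -1 <= x <= y, and s + t = 1: the product with the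
    factor is a convex combination of F and of its delayed series. *)
Lemma expands_factor x y a F : -1 <= x -> x <= y -> 0 <= y -> unit_coefs a ->
  expands (fun n => (a n)%:C) F ->
  exists b, unit_coefs b /\ expands (fun n => (b n)%:C)
    (fun z => (1 - x%:C * (z - 1)) / (1 - y%:C * (z - 1)) * F z).
Proof.
move=> x1 xy y0 ua aF; have y1 : 0 < 1 + y by rewrite ltr_wpDr.
have du := delay_unit y0 ua.
pose s := (1 + x) / (1 + y); pose t := (y - x) / (1 + y).
have s0 : 0 <= s by rewrite divr_ge0 ?(ltW y1)//; lra.
have t0 : 0 <= t by rewrite divr_ge0 ?(ltW y1)//; lra.
have st : s + t = 1.
  by rewrite /s /t; field; rewrite gt_eqF.
have [[a0 a1] [e0 e1]] := (ua, du).
exists (fun n => s * a n + t * delay y a n); split.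
  split=> [n|N]; first by apply: addr_ge0; apply: mulr_ge0.
  rewrite big_split/= -!mulr_sumr -[leRHS]st lerD//.
    by apply: ler_piMr; [|exact: a1].
  by apply: ler_piMr; [|exact: e1].
move=> z z1; have d0 := denominator_neq0 y0 (ltW z1).
have y1C : 1 + y%:C != 0 by rewrite -(rmorph1 (real_complex R)) -rmorphD fmorph_eq0 gt_eqF.
have -> : (fun N => \sum_(n < N) (s * a n + t * delay y a n)%:C * z ^+ n : R[i]^o) =
  (fun N => s%:C *: (\sum_(n < N) (a n)%:C * z ^+ n : R[i]^o) +
     t%:C *: (\sum_(n < N) (delay y a n)%:C * z ^+ n : R[i]^o)).
  apply/funext => N; rewrite !scaler_sumr -big_split/=.
  apply: eq_bigr => n _; rewrite rmorphD !rmorphM/= -![_ *: _]/(_ * _); ring.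
cbv beta; rewrite (_ : _ * F z =
   s%:C *: F z + t%:C *: (z * F z / (1 - y%:C * (z - 1)) : R[i]^o)); last first.
  rewrite -![_ *: _]/(_ * _) /s /t !fmorph_div/= !rmorphB !rmorphD rmorph1/=.
  by field; rewrite d0 y1C.
by apply: cvgD; apply: cvgZ; try exact: cvg_cst;
  [exact: aF|exact: expands_delay].
Qed.

Lemma expands_tail a F z N : (forall n, 0 <= a n <= 1) ->
  expands (fun n => (a n)%:C) F -> cnorm z < 1 ->
  cnorm (F z - \sum_(n < N) (a n)%:C * z ^+ n) <= cnorm z ^+ N / (1 - cnorm z).
Proof.
move=> ua aF z1; have z0 := cnorm_ge0 z.
have shift : (fun M => \sum_(n < M + N) (a n)%:C * z ^+ n : R[i]^o) @ \oo --> F z.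
  by have := aF _ z1; rewrite -(cvg_shiftn N).
have L := cvg_cnorm (cvgB shift (cvg_cst (\sum_(n < N) (a n)%:C * z ^+ n : R[i]^o))).
apply: (cvgr_to_le (L _ _ _)); apply: nearW => M; rewrite !fctE.
rewrite addnC big_split_ord/= addrAC subrr add0r.
apply: le_trans (cnorm_sum _ _ _) _.
apply: (@le_trans _ _ (\sum_(i < M) cnorm z ^+ N * cnorm z ^+ i)).
  apply: ler_sum => i _; rewrite Normc.normcM cnormX cnorm_real -exprD.
  have /andP[u0 u1] := ua (N + i)%N.
  by rewrite ger0_norm// ler_piMl ?exprn_ge0.
rewrite -mulr_sumr ler_wpM2l ?exprn_ge0//.
have d0 : 0 < 1 - cnorm z by rewrite subr_gt0.
rewrite -[leRHS]mul1r ler_pdivlMr// mulrC -opprB mulNr -subrX1 opprB.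
by rewrite gerBl exprn_ge0.
Qed.

End UnitCoefficients.

(** * Power series of the functions in the class *)

Section DiskSeries.
Variable R : realType.
Implicit Types (a : nat -> R) (f : disk R -> R[i]) (s : seq (R * R)).

(** The remainder bound, rather than mere convergence, is recorded: its size
    depends only on z and N, so it survives limits both in f and in a. *)
Definition disk_series a f := (forall n, 0 <= a n <= 1) /\
  forall z : disk R, cnorm (val z) < 1 -> forall N,
    cnorm (f z - \sum_(n < N) (a n)%:C * val z ^+ n) <=
    cnorm (val z) ^+ N / (1 - cnorm (val z)).

(** The rational function on the whole plane, of which [ratfun] is the
    restriction to the closed disk. *)
Definition ratC s (z : R[i]) : R[i]^o := \prod_(xy <- s)
  ((1 - xy.1%:C * (z - 1)) / (1 - xy.2%:C * (z - 1))).

Lemma ratC_series p s : admissible p s ->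
  exists a, unit_coefs a /\ expands (fun n => (a n)%:C) (ratC s).
Proof.
elim: s => [_|[x y] s IHs ads].
  exists (fun n => (n == 0%N)%:R); split.
    split=> [n|[|N]]; first exact: ler0n.
      by rewrite big_ord0.
    by rewrite big_ord_recl big1 ?addr0.
  move=> z _; apply: cvg_near_cst; exists 1%N => // -[//|N] _ /=.
  rewrite /ratC big_nil big_ord_recl big1 => [|i _]; last by rewrite mul0r.
  by rewrite rmorph1 mulr1 addr0.
have [|a [ua aF]] := IHs; first by move=> xy sxy; apply: ads; rewrite inE sxy orbT.
have [|/andP[/= x1 _] /= y0 /= xy] := ads (x, y); first exact: mem_head.
have [b [ub bF]] := @expands_factor _ x y a (ratC s) x1 xy y0 ua aF.
exists b; split; first exact: ub.
by move=> z z1; rewrite /ratC big_cons; exact: bF.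
Qed.

Lemma ratfun_series p s : admissible p s -> exists a, disk_series a (ratfun s).
Proof.
move=> /ratC_series[a [ua aF]]; exists a.
have a01 n : 0 <= a n <= 1 by rewrite (proj1 ua) unit_coefs_le1.
by split=> // z z1 N; exact: (expands_tail N a01 aF z1).
Qed.

Lemma disk_near (f : diskfun R) e : 0 < e ->
  nbhs f [set g : diskfun R | forall z, cnorm (f z - g z) < e].
Proof.
move=> e0; apply/uniform_nbhs.
have e0' : 0 < e%:C by rewrite ltcR.
exists [set xy : R[i]^o * R[i]^o | ball xy.1 e%:C xy.2]; split.
  exact: entourage_ball (PosNum e0').
by move=> g /= fg z; have := fg z I; rewrite -ball_normE/= cnormE ltcR.
Qed.

(** An ultrafilter contains each set or its complement, and so does its
    image. *)
Lemma ultra_fmap (T U : Type) (F : set_system T) (f : T -> U) :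
  UltraFilter F -> UltraFilter (f @ F).
Proof.
move=> UF; split=> [|G GP FG]; first exact: fmap_proper_filter.
apply/seteqP; split=> // A GA.
have [//|FnA] := in_ultra_setVsetC (f @^-1` A) UF.
have GnA : G (~` A) by exact: FG.
have : G (A `&` ~` A) by exact: filterI.
by rewrite setICr => /(@filter_not_empty _ _ GP).
Qed.

(** The coefficient sequences live in the compact cube of sequences in [0,1].
    An ultrafilter finer than the one at infinity makes all of them converge
    at once, with no extraction of subsequences. *)
Lemma calF_series p (f : diskfun R) : calF p f -> exists a, disk_series a f.
Proof.
move=> [s [ads sf]].
have /choice [a af] k := ratfun_series (ads k).
have [U [UU ooU]] := @ultraFilterLemma nat \oo _.
have Uf : ratfun (s k) @[k --> U] --> (f : diskfun R).
  by apply: cvg_trans sf; exact: cvg_app.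
have /choice [c ac] n : exists l : R, a k n @[k --> U] --> l /\ 0 <= l <= 1.
  have := @segment_compact R 0 1; rewrite compact_ultra.
  move=> /(_ (a k n @[k --> U])) [].
  - exact: ultra_fmap.
  - by apply: nearW => k /=; rewrite in_itv/= (proj1 (af k)).
  by move=> l [/=]; rewrite in_itv/= => l01 al; exists l.
exists c; split=> [n|z z1 N]; first exact: (ac n).2.
apply/ler_addgt0Pr => e e0; have e20 : 0 < e / 2 by rewrite divr_gt0.
have L d : 0 < d -> \forall k \near U,
    cnorm (\sum_(n < N) (c n - a k n)%:C * val z ^+ n) < d.
  elim: N d => [|n IHn] d d0.
    by apply: nearW => k; rewrite big_ord0 Normc.normc0.
  have d20 : 0 < d / 2 by rewrite divr_gt0.
  have /cvgrPdist_lt/(_ _ d20) := (ac n).1.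
  apply: filterS2 (IHn _ d20) => k Sk ck; rewrite big_ord_recr/=.
  apply: le_lt_trans (le_normcD _ _) _.
  rewrite [ltRHS]splitr ltrD// Normc.normcM cnormX cnorm_real.
  by apply: le_lt_trans ck; rewrite ler_piMr// exprn_ile1 ?cnorm_ge0// ltW.
have [k [h1 h2]] : exists k, (cnorm (f z - ratfun (s k) z) < e / 2) /\
    cnorm (\sum_(n < N) (c n - a k n)%:C * val z ^+ n) < e / 2.
  apply: (@filter_ex _ U); apply: filterI.
    by apply: (@filterS _ U _ _ _ _ (Uf _ (disk_near f e20))) => k; apply.
  exact: L.
have h3 := (af k).2 z z1 N.
rewrite (_ : f z - _ = (f z - ratfun (s k) z) +
   (ratfun (s k) z - \sum_(n < N) (a k n)%:C * val z ^+ n) -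
   \sum_(n < N) (c n - a k n)%:C * val z ^+ n); last first.
  rewrite (_ : \sum_(n < N) (c n - a k n)%:C * val z ^+ n =
    \sum_(n < N) (c n)%:C * val z ^+ n - \sum_(n < N) (a k n)%:C * val z ^+ n).
    by ring.
  by rewrite -sumrB; apply: eq_bigr => n _; rewrite rmorphB mulrBl.
apply: le_trans (le_normcD _ _) _; rewrite normcN.
apply: le_trans (lerD (le_trans (le_normcD _ _) (lerD (ltW h1) h3)) (ltW h2)) _.
by rewrite [e / 2 + _]addrC -addrA -splitr.
Qed.

Lemma disk_normE (z : R[i]) : (`|z| <= 1) = (cnorm z <= 1).
Proof. by rewrite cnormE -(rmorph1 (real_complex R)) lecR. Qed.

Lemma disk_cnorm (z : disk R) : cnorm (val z) <= 1.
Proof. by rewrite -disk_normE (valP z). Qed.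

Lemma disk_series_expands a f : disk_series a f ->
  expands (fun n => (a n)%:C) (ext0 f).
Proof.
move=> [a01 af] z z1; have z1' : `|z| <= 1 by rewrite disk_normE ltW.
have d0 : 0 < 1 - cnorm z by rewrite subr_gt0.
rewrite /ext0 insubT/=; apply/cvg_cnormP => e e0.
have /cvgrPdist_lt/(_ (e * (1 - cnorm z)) _) := cvg_cnorm_expr z1.
rewrite mulr_gt0// => /(_ isT); apply: filterS => N.
rewrite sub0r normrN ger0_norm ?exprn_ge0 ?cnorm_ge0// => zN.
apply: le_lt_trans (af (exist _ z z1') z1 N) _.
by rewrite ltr_pdivrMr.
Qed.

Lemma disk_series_taylor a f k : disk_series a f ->
  taylor_coef f k = (a k)%:C.
Proof.
move=> af; have a01 := af.1; rewrite /taylor_coef (derive1n_expands k _ (disk_series_expands af)).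
  rewrite mulrC mulKf// pnatr_eq0 -lt0n fact_gt0//.
move=> r /andP[r0 r1]; exists 1 => n; rewrite cnorm_real.
by have /andP[an0 an1] := a01 n; rewrite ger0_norm// mulr_ile1 ?exprn_ge0 ?exprn_ile1// ltW.
Qed.

End DiskSeries.

Section Determination.
Variables (R : realType) (p : R).
Implicit Types (a : nat -> R) (f g : diskfun R) (s : seq (R * R)).

(** The denominators do not vanish on the closed disk, so the rational
    functions are continuous up to the boundary. *)
Lemma ratC_cvg s (u : nat -> R[i]) (z : R[i]) : admissible p s ->
  cnorm z <= 1 -> (u n : R[i]^o) @[n --> \oo] --> (z : R[i]^o) ->
  ratC s (u n) @[n --> \oo] --> ratC s z.
Proof.
move=> + z1 uz; elim: s => [_|[x y] s IHs ads].
  have -> : (fun n => ratC [::] (u n)) = (fun=> ratC [::] z).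
    by apply/funext => n; rewrite /ratC !big_nil.
  exact: cvg_cst.
have {}IHs := IHs _.
have -> : (fun n => ratC ((x, y) :: s) (u n)) =
  (fun n => (1 - x%:C * (u n - 1)) / (1 - y%:C * (u n - 1)) * ratC s (u n)).
  by apply/funext => n; rewrite /ratC big_cons.
rewrite {2}/ratC big_cons.
have lin (c : R) : (1 - c%:C * (u n - 1) : R[i]^o) @[n --> \oo] --> (1 - c%:C * (z - 1) : R[i]^o).
  have E w : 1 - c%:C * (w - 1) = (1 + c)%:C - c%:C *: (w : R[i]^o) :> R[i]^o.
    by rewrite -[_ *: _]/(_ * _) rmorphD rmorph1; ring.
  rewrite E; under eq_fun do rewrite E.
  apply: cvgB; first exact: cvg_cst.
  by apply: cvgZ; first exact: cvg_cst.
have [|_ y0 _] := ads (x, y); first exact: mem_head.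
apply: cvgM; last first.
  by apply: IHs => xy sxy; apply: ads; rewrite inE sxy orbT.
apply: cvgM; first exact: lin.
by apply: cvgV; [exact: denominator_neq0|exact: lin].
Qed.

Lemma radius_cvg (z : R[i]) :
  ((1 - n.+1%:R^-1)%:C * z : R[i]^o) @[n --> \oo] --> (z : R[i]^o).
Proof.
apply/cvg_cnormP => e e0.
have /cvgrPdist_lt/(_ (e / (cnorm z + 1)) _) := @cvg_harmonic R.
have z1 : 0 < cnorm z + 1 by rewrite ltr_wpDl ?cnorm_ge0.
rewrite divr_gt0// => /(_ isT); apply: filterS => n; rewrite sub0r normrN => nz.
rewrite (_ : _ - _ = (n.+1%:R^-1)%:C * z); last first.
  by rewrite rmorphB rmorph1/=; ring.
rewrite Normc.normcM cnorm_real.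
apply: (@le_lt_trans _ _ (`|harmonic n| * (cnorm z + 1))).
  by rewrite ler_wpM2l// lerDl.
by rewrite -ltr_pdivlMr.
Qed.

Lemma shrink_subproof (z : disk R) n : `|(1 - n.+1%:R^-1)%:C * val z| <= 1 :> R[i].
Proof.
rewrite disk_normE Normc.normcM cnorm_real mulr_ile1 ?cnorm_ge0 ?disk_cnorm//.
by rewrite ger0_norm ?subr_ge0 ?gerBl ?invr_ge0// invf_le1// ler1n.
Qed.

Definition shrink (z : disk R) n : disk R := 
  exist (fun w : R[i] => `|w| <= 1) _ (shrink_subproof z n).

Lemma shrink_lt1 (z : disk R) n : cnorm (val (shrink z n)) < 1.
Proof.
rewrite /= Normc.normcM cnorm_real ger0_norm; last first.
  by rewrite subr_ge0 invf_le1// ler1n.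
apply: (@le_lt_trans _ _ (1 - n.+1%:R^-1)); last by rewrite gtrBl invr_gt0.
by rewrite ler_piMr ?disk_cnorm// subr_ge0 invf_le1// ler1n.
Qed.

(** Uniform limits of functions that are continuous up to the boundary have
    radial limits there. *)
Lemma calF_radial f (z : disk R) : calF p f ->
  (f (shrink z n) : R[i]^o) @[n --> \oo] --> (f z : R[i]^o).
Proof.
move=> [s [ads sf]]; apply/cvg_cnormP => e e0.
have e30 : 0 < e / 3 by rewrite divr_gt0.
have [k fk] : exists k, forall w, cnorm (f w - ratfun (s k) w) < e / 3.
  by apply: (@filter_ex _ \oo); exact: sf (disk_near f e30).
have /cvg_cnormP/(_ _ e30) := ratC_cvg (ads k) (disk_cnorm z) (@radius_cvg (val z)).
apply: filterS => n.
rewrite -[ratC _ (val z)]/(ratfun (s k) z).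
rewrite -[ratC _ _]/(ratfun (s k) (shrink z n)).
have := fk (shrink z n); have := fk z; rewrite (cnormBC (f (shrink z n))).
move: (f z) (ratfun (s k) z) (f (shrink z n)) (ratfun (s k) (shrink z n)).
move=> t v w u h1 h2 h3.
rewrite (_ : t - w = (t - v) + (v - u) + (u - w)); last by ring.
have := le_normcD (t - v + (v - u)) (u - w).
have := le_normcD (t - v) (v - u); lra.
Qed.

(** The coefficients give the values inside the disk by summation, and those
    on the circle by [calF_radial]. *)
Lemma calF_taylor_inj f g : calF p f -> calF p g ->
  (forall k, taylor_coef f k = taylor_coef g k) -> f = g.
Proof.
move=> Ff Fg fg; have [a af] := calF_series Ff; have [b bg] := calF_series Fg.
have ab : a = b.
  apply/funext => k; apply: (@complexI R).
  by rewrite -(disk_series_taylor k af) -(disk_series_taylor k bg).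
rewrite -{b}ab in bg.
have inner (z : disk R) : cnorm (val z) < 1 -> f z = g z.
  move=> z1; have := disk_series_expands af z1.
  have := disk_series_expands bg z1; rewrite /ext0 !valK/= => gz fz.
  exact: (cvg_unique (@norm_hausdorff _ R[i]^o) fz gz).
apply/funext => z; have fz := calF_radial (z := z) Ff.
have gz := calF_radial (z := z) Fg.
rewrite (_ : (fun n => f (shrink z n)) = (fun n => g (shrink z n))) in fz.
  exact: (cvg_unique (@norm_hausdorff _ R[i]^o) fz gz).
by apply/funext => n; rewrite inner// shrink_lt1.
Qed.

End Determination.

(** * Taylor coefficients as Borel functions *)

Section Coef.
Variables (R : realType) (p : R).

(** The real part loses nothing, by [taylor_coefE]. *)
Definition tcoef (Phi : Fspace p) (k : nat) : R :=
  complex.Re (taylor_coef (Ffun Phi) k).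

Lemma Ffun_calF (Phi : Fspace p) : calF p (Ffun Phi).
Proof. exact: set_valP. Qed.

Lemma Ffun_series (Phi : Fspace p) : disk_series (tcoef Phi) (Ffun Phi).
Proof.
have [a af] := calF_series (Ffun_calF Phi).
rewrite (_ : tcoef Phi = a)//.
by apply/funext => k; rewrite /tcoef (disk_series_taylor k af).
Qed.

Lemma taylor_coefE (Phi : Fspace p) k : taylor_coef (Ffun Phi) k = (tcoef Phi k)%:C.
Proof. exact: disk_series_taylor (Ffun_series Phi). Qed.

Lemma tcoef01 (Phi : Fspace p) k : 0 <= tcoef Phi k <= 1.
Proof. exact: (Ffun_series Phi).1. Qed.

Lemma tcoef_inj (Phi Psi : Fspace p) :
  (forall k, tcoef Phi k = tcoef Psi k) -> Phi = Psi.
Proof.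
move=> PhiPsi; apply: val_inj.
apply: (calF_taylor_inj (Ffun_calF Phi) (Ffun_calF Psi)) => k.
by rewrite !taylor_coefE PhiPsi.
Qed.

Lemma eval_continuous (z : disk R) :
  continuous (fun Phi : Fspace p => complex.Re (Ffun Phi z) : R^o).
Proof.
move=> Phi.
have L : (Ffun Psi z : R[i]^o) @[Psi --> nbhs Phi] --> (Ffun Phi z : R[i]^o).
  apply/cvg_cnormP => e e0.
  have near_Phi : nbhs Phi (set_val @^-1`
      [set g : diskfun R | forall w, cnorm (set_val Phi w - g w) < e]).
    exact: (@initial_continuous _ _ (@set_val _ (calF p)) Phi _ (disk_near _ e0)).
  by apply: (@filterS _ (nbhs Phi) _ _ _ _ near_Phi) => Psi; apply.
exact: cvg_Re L.
Qed.

Lemma eval_measurable (z : disk R) :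
  measurable_fun [set: Fborel p] (fun Phi => complex.Re (Ffun Phi z)).
Proof.
apply: (measurability _ (RGenOpens.measurableE R)) => _ [_ [x [y ->]] <-].
rewrite setTI; apply: sub_sigma_algebra.
by have /continuousP := @eval_continuous z; apply; exact: interval_open.
Qed.

Lemma inv_point_subproof n : `|(n.+2%:R^-1)%:C| <= 1 :> R[i].
Proof. by rewrite disk_normE cnorm_real ger0_norm// invf_le1// ler1n. Qed.

Definition inv_point n : disk R :=
  exist (fun w : R[i] => `|w| <= 1) _ (inv_point_subproof n).

(** With t = 1/(n+2), this is the remainder bound of order k+1 divided by t^k,
    since t / (1 - t) = 1/(n+1). *)
Lemma tcoef_approx (Phi : Fspace p) k n :
  `|tcoef Phi k - n.+2%:R ^+ k * (complex.Re (Ffun Phi (inv_point n)) -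
      \sum_(j < k) tcoef Phi j * n.+2%:R^-1 ^+ j)| <= n.+1%:R^-1.
Proof.
have t1 : cnorm (val (inv_point n)) = n.+2%:R^-1.
  by rewrite -[val _]/((n.+2%:R^-1)%:C) cnorm_real ger0_norm.
have t0 : 0 < n.+2%:R^-1 :> R by rewrite invr_gt0.
have := (Ffun_series Phi).2 (inv_point n) _ k.+1.
rewrite t1 invf_lt1// ltr1n => /(_ isT).
move=> /(le_trans (cnorm_Re _)).
rewrite (raddfB (@complex.Re R)).
rewrite [X in _ - X](_ : _ = \sum_(j < k.+1) tcoef Phi j * n.+2%:R^-1 ^+ j); last first.
  rewrite (raddf_sum (@complex.Re R)); apply: eq_bigr => j _.
  by rewrite /= -rmorphXn -rmorphM.
rewrite big_ord_recr/=; set S := \sum_(j < k) _; set u := complex.Re _.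
move: t0; set t : R := n.+2%:R^-1 => t0.
have tn : n.+2%:R = t^-1 by rewrite invrK.
have tn1 : n.+1%:R = t^-1 - 1 by rewrite -tn -(natr1 n.+1) addrK.
have t_lt1 : t < 1 by rewrite invf_lt1// ltr1n.
clearbody S u t => {t1}.
have -> : t ^+ k.+1 / (1 - t) = t ^+ k * n.+1%:R^-1.
  rewrite tn1 exprS; field.
  by rewrite mulN1r subr_eq0 !gt_eqF.
move=> h; rewrite -(ler_pM2l (exprn_gt0 k t0)).
apply: le_trans h; rewrite -{1}(gtr0_norm (exprn_gt0 k t0)) -normrM tn.
rewrite le_eqVlt; apply/orP; left; apply/eqP.
rewrite -normrN; congr `|_|; rewrite exprVn.
have : t ^+ k != 0 by rewrite expf_neq0// gt_eqF.
by move: (t ^+ k) => q q0; field.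
Qed.

Lemma tcoef_measurable k : measurable_fun [set: Fborel p] (tcoef^~ k).
Proof.
elim/ltn_ind: k => k IHk.
apply: (@measurable_fun_cvg _ (Fborel p) R _ (fun n Phi =>
  n.+2%:R ^+ k * (complex.Re (Ffun Phi (inv_point n)) -
      \sum_(j < k) tcoef Phi j * n.+2%:R^-1 ^+ j))) => [n|Phi _].
  apply: measurable_funM => //; apply: measurable_funB.
    exact: eval_measurable.
  apply: measurable_sum => j; apply: measurable_funM => //.
  exact: IHk.
apply/cvgrPdist_le => e e0.
have /cvgrPdist_lt/(_ _ e0) := @cvg_harmonic R.
apply: filterS => n; rewrite sub0r normrN ger0_norm ?invr_ge0// => ne.
exact: le_trans (tcoef_approx Phi k n) (ltW ne).
Qed.

End Coef.

(** * Grothendieck polynomials in one and two variables *)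

Lemma det_mx22 (A : comRingType) (M : 'M[A]_2) :
  \det M = M ord0 ord0 * M ord_max ord_max - M ord0 ord_max * M ord_max ord0.
Proof.
rewrite (expand_det_row _ ord0) !big_ord_recl big_ord0 addr0 /cofactor !det_mx11.
rewrite !mxE /= expr0 expr1 !mul1r mulrA mulrN1 -mulNr.
by congr (_ * M _ _ + - _ * M _ _); try congr (M _ _); apply/val_inj.
Qed.

(** The subtractions and the trivial powers on the right are those of the
    expanded 2 x 2 determinant. *)
Lemma bialternant2 (A : comRingType) (X Y P : A) b d :
  (X * Y) ^+ b * (X ^+ d.+1 - Y ^+ d.+1) -
    P * ((X * Y) ^+ b.+1 * (X ^+ d - Y ^+ d)) =
  X ^+ (b + d + (2 - 1)) * (1 - P * X) ^+ 0 *
    (Y ^+ (b + (2 - 2)) * (1 - P * Y) ^+ 1) -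
  X ^+ (b + (2 - 2)) * (1 - P * X) ^+ 1 *
    (Y ^+ (b + d + (2 - 1)) * (1 - P * Y) ^+ 0).
Proof.
rewrite !subSS !subn0 addn0 addn1 !expr0 !expr1 -addnS !exprD !exprMn !exprS.
ring.
Qed.

Definition part1 (k : nat) : part 1 := exist (sorted geq : pred (1.-tuple nat)) [tuple k] isT.

Lemma part1K (l : part 1) : part1 (part_nth l ord0) = l.
Proof.
apply/val_inj/eq_from_tnth => i /=; rewrite (tnth_nth 0%N) /part_nth.
by rewrite !(ord1 i).
Qed.

Lemma pair_part_subproof (a b : nat) :
  sorted geq [tuple maxn a b; minn a b].
Proof. by rewrite /= andbT leq_max geq_min leqnn. Qed.

(** The maximum and the minimum make the pair a partition for all a and b,
    so that no proof of b <= a has to be carried by the index. *)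
Definition pair_part (a b : nat) : part 2 :=
  exist (sorted geq : pred (2.-tuple nat)) _ (pair_part_subproof a b).

Lemma pair_part0 a b : part_nth (pair_part a b) ord0 = maxn a b.
Proof. by []. Qed.

Lemma pair_part1 a b : part_nth (pair_part a b) ord_max = minn a b.
Proof. by []. Qed.

Lemma part2_sorted (l : part 2) : (part_nth l ord_max <= part_nth l ord0)%N.
Proof.
case: l => -[[|a [|b []]] // sz] /= sab; rewrite /part_nth !(tnth_nth 0%N) /=.
by move: sab; rewrite /= andbT.
Qed.

Lemma pair_partK (l : part 2) :
  pair_part (part_nth l ord0) (part_nth l ord_max) = l.
Proof.
have ba := part2_sorted l.
apply/val_inj/eq_from_tnth => i /=; rewrite (tnth_nth 0%N).
have [->|->] : i = ord0 \/ i = ord_max.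
- by case: i => -[|[|//]] ?; [left|right]; apply/val_inj.
- exact: (maxn_idPl ba).
- exact: (minn_idPr ba).
Qed.

Section Groth.
Variables (R : realType) (p : R).
Local Notation C := R[i].
Local Notation x := (mvar R (ord0 : 'I_2)).
Local Notation y := (mvar R (ord_max : 'I_2)).

Lemma groth_uniq n (l : part n) (q : mpoly n C) : groth_den R n != 0 ->
  q * groth_den R n = groth_num p l -> groth p l = q.
Proof.
move=> d0 qd; apply: (mulIf d0); rewrite qd.
by apply: (@xgetPex _ 0 [set q | q * groth_den R n = groth_num p l]); exists q.
Qed.

Lemma groth_den1 : groth_den R 1 = 1.
Proof. by rewrite /groth_den det_mx11 mxE expr0. Qed.

Lemma groth_part1 (l : part 1) : groth p l = mvar R ord0 ^+ part_nth l ord0.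
Proof.
apply: groth_uniq; rewrite groth_den1 ?oner_eq0// mulr1.
by rewrite /groth_num det_mx11 mxE addn0 expr0 mulr1.
Qed.

Lemma groth_den2 : groth_den R 2 = x - y.
Proof.
by rewrite /groth_den det_mx22 !mxE /= !expr1 !expr0 mulr1 mul1r.
Qed.

Lemma groth_den2_neq0 : groth_den R 2 != 0.
Proof.
rewrite groth_den2; apply/eqP => /(congr1 (meval (fun i => (i == ord0)%:R))).
by rewrite rmorphB rmorph0 /= !mevalXU subr0 => /eqP; rewrite oner_eq0.
Qed.

(** The Schur polynomial of (c + n - 1, c), which is (x y)^c times the complete
    homogeneous polynomial of degree n - 1; it is 0 for n = 0. *)
Definition complete2 (c n : nat) : mpoly 2 C :=
  \sum_(i < n) x ^+ (c + (n.-1 - i)) * y ^+ (c + i).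

Lemma complete2_den c n :
  complete2 c n * (x - y) = (x * y) ^+ c * (x ^+ n - y ^+ n).
Proof.
rewrite subrXX mulrCA [RHS]mulrC mulr_sumr; congr (_ * _).
by apply: eq_bigr => i _; rewrite exprMn !exprD mulrACA.
Qed.

(** That is G_(a,b) = s_(a,b) - p s_(a,b+1): expanding the factor 1 - p x of
    the second column splits the determinant into the numerators of these two
    Schur polynomials. *)
Lemma groth_part2 (l : part 2) :
  let a := part_nth l ord0 in let b := part_nth l ord_max in
  groth p l = complete2 b (a - b).+1 - mpolyC 2 p%:C * complete2 b.+1 (a - b).
Proof.
move=> a b; have ba : (b <= a)%N := part2_sorted l.
apply: groth_uniq; first exact: groth_den2_neq0.
rewrite groth_den2 mulrBl -mulrA !complete2_den /groth_num det_mx22 !mxE /=.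
rewrite -[part_nth l ord0]/a -[part_nth l ord_max]/b.
have [d aE] : exists d, a = (b + d)%N by exists (a - b)%N; rewrite subnKC.
rewrite aE addKn; exact: bialternant2.
Qed.

Lemma mcoeff_xy (m : multinom 2) i j : mcoeff m (x ^+ i * y ^+ j) =
  ((m ord0 == i) && (m ord_max == j))%:R.
Proof.
rewrite /mvar !mpolyXn -mpolyXD mcoeffX; congr (_ %:R); congr nat_of_bool.
apply/eqP/andP => [<-|[/eqP mi /eqP mj]].
  by rewrite !mnmDE !mulmnE !mnm1E /= !mul1n !mul0n addn0 !eqxx.
apply/mnmP => k; rewrite mnmDE !mulmnE !mnm1E.
have [->|->] : k = ord0 \/ k = ord_max.
- by case: k => -[|[|//]] ?; [left|right]; apply/val_inj.
- by rewrite /= mul1n mul0n addn0 mi.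
- by rewrite /= mul1n mul0n add0n mj.
Qed.

(** Each monomial of degree 2c + n - 1 with both exponents at least c occurs
    once.  The degree condition is written with a successor so that it
    is also correct for n = 0, where it has no solution. *)
Lemma mcoeff_complete2 (m : multinom 2) c n : mcoeff m (complete2 c n) =
  ([&& (m ord0 + m ord_max).+1 == c + c + n,
      c <= m ord0 & c <= m ord_max]%N)%:R.
Proof.
rewrite /complete2 raddf_sum /=; under eq_bigr do rewrite mcoeff_xy.
case: (boolP [&& _, _ & _]) => [/and3P[/eqP mn cm0 cm1]|].
  have lt_n : (m ord_max - c < n)%N by lia.
  rewrite (bigD1 (Ordinal lt_n))//= big1 => [|i ni].
    rewrite addr0; apply/eqP; rewrite (_ : _ && _) => //.
    by apply/andP; split; apply/eqP; lia.
  rewrite (_ : _ && _ = false)//; apply/negP => /andP[_ /eqP mi].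
  by move: ni; rewrite -val_eqE/= mi addKn eqxx.
move=> h; rewrite big1// => i _; rewrite (_ : _ && _ = false)//.
apply/negP => /andP[/eqP m0 /eqP m1]; move: h; rewrite m0 m1.
by have := ltn_ord i; lia.
Qed.

Lemma groth1_part1 (l : part 1) : groth1 p l = 1.
Proof. by rewrite /groth1 groth_part1 rmorphXn /= mevalXU expr1n. Qed.

Lemma groth1_part2 (l : part 2) :
  let d := (part_nth l ord0 - part_nth l ord_max)%N in
  groth1 p l = (d.+1%:R - p * d%:R)%:C.
Proof.
have complete2_1 c n : meval (fun=> 1) (complete2 c n) = n%:R.
  rewrite /complete2 rmorph_sum /= (eq_bigr (fun=> 1)) => [|i _].
    by rewrite sumr_const card_ord.
  by rewrite rmorphM !rmorphXn /= !mevalXU !expr1n mulr1.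
move=> d; rewrite /groth1 groth_part2 rmorphB rmorphM /= mevalC !complete2_1.
by rewrite -/d rmorphB rmorphM !rmorph_nat.
Qed.

Lemma mcoeff_groth_part1 (m : multinom 1) (l : part 1) :
  mcoeff m (groth p l) = (l == part1 (m ord0))%:R.
Proof.
rewrite groth_part1 mcoeffXn; congr (nat_of_bool _)%:R.
apply/eqP/eqP => [<-|->].
  by rewrite mulmnE mnm1E mul1n part1K.
by apply/mnmP => i; rewrite mulmnE mnm1E (ord1 i) mul1n.
Qed.

Lemma is_expansion1 (f : disk R -> C) (M : part 1 -> C) :
  is_expansion p f M <-> forall k, M (part1 k) = taylor_coef f k.
Proof.
have sumE (m : multinom 1) :
    \sum_(l \in [set: part 1]) (M l * (mcoeff m (groth p l) / groth1 p l)) =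
    M (part1 (m ord0)).
  rewrite -(fsbig_widen [set part1 (m ord0)])//= => [|l [_ /eqP lm]].
    by rewrite fsbig_set1 mcoeff_groth_part1 groth1_part1 eqxx divr1 mulr1.
  by rewrite /= mcoeff_groth_part1 (negPf lm) mul0r mulr0.
split=> [fM k|Mf m]; last by rewrite sumE big_ord_recl big_ord0 mulr1 Mf.
have := fM (Multinom [tuple k | i < 1]).
by rewrite sumE big_ord_recl big_ord0 mulr1 mnmE.
Qed.

Lemma Mnum1 (f : disk R -> C) k : Mnum p f (part1 k) = taylor_coef f k.
Proof.
have : is_expansion p f (@Mnum R p f 1).
  apply: (@xgetPex _ (fun=> 0) [set M : part 1 -> C | is_expansion p f M]).
  exists (fun l => taylor_coef f (part_nth l ord0)).
  by apply/is_expansion1.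
by move=> /is_expansion1; apply.
Qed.

(** The coefficient of x^i y^j in the sum of w(a,b) G_(a,b): a partition of
    degree i + j contributes through s_(a,b) when b <= min(i,j), and one of
    degree i + j - 1 through - p s_(a,b+1) when b < min(i,j). *)
Definition two_row_sum (w : nat -> nat -> C) i j : C :=
  \sum_(b < (minn i j).+1) w (i + j - b)%N b -
  p%:C * \sum_(b < minn i j) w (i + j - b.+1)%N b.

(** Only finitely many partitions see a given monomial; they are listed in r1,
    for s_(a,b), and r2, for - p s_(a,b+1). *)
Lemma sum_part2 (N : part 2 -> C) (m : multinom 2) :
  \sum_(l \in [set: part 2]) N l * mcoeff m (groth p l) =
  two_row_sum (fun a b => N (pair_part a b)) (m ord0) (m ord_max).
Proof.
set i := m ord0; set j := m ord_max.
pose r1 := [seq pair_part (i + j - b) b | b <- iota 0 (minn i j).+1].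
pose r2 := [seq pair_part (i + j - b.+1) b | b <- iota 0 (minn i j)].
have coefE (l : part 2) : mcoeff m (groth p l) =
    (l \in r1)%:R - p%:C * (l \in r2)%:R.
  rewrite groth_part2 raddfB /= mcoeffCM !mcoeff_complete2 -/i -/j.
  have ba := part2_sorted l.
  congr (_ - p%:C * _); congr (nat_of_bool _)%:R.
    apply/idP/mapP => [/and3P[/eqP ij bi bj]|[b]].
      exists (part_nth l ord_max); first by rewrite mem_iota; lia.
      rewrite -[LHS]pair_partK; congr (pair_part _ _); lia.
    rewrite mem_iota => bm ->; rewrite pair_part0 pair_part1.
    by apply/and3P; split; [apply/eqP| |]; lia.
  apply/idP/mapP => [/and3P[/eqP ij bi bj]|[b]].
    exists (part_nth l ord_max); first by rewrite mem_iota; lia.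
    rewrite -[LHS]pair_partK; congr (pair_part _ _); lia.
  rewrite mem_iota => bm ->; rewrite pair_part0 pair_part1.
  by apply/and3P; split; [apply/eqP| |]; lia.
have u1 : uniq r1.
  rewrite map_inj_in_uniq ?iota_uniq// => b b'; rewrite !mem_iota => bm bm'.
  move=> /(congr1 (fun l => part_nth l ord_max)); rewrite !pair_part1; lia.
have u2 : uniq r2.
  rewrite map_inj_in_uniq ?iota_uniq// => b b'; rewrite !mem_iota => bm bm'.
  move=> /(congr1 (fun l => part_nth l ord_max)); rewrite !pair_part1; lia.
pose s := undup (r1 ++ r2).
have sum_s (r : seq (part 2)) : uniq r -> {subset r <= s} ->
    \sum_(l <- s) N l * (l \in r)%:R = \sum_(l <- r) N l.
  move=> ur rs; under eq_bigr do rewrite mulr_natr mulrb.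
  rewrite -big_mkcond -big_filter; apply: perm_big; apply: uniq_perm => //.
    by rewrite filter_uniq// undup_uniq.
  by move=> l; rewrite mem_filter andb_idr//; exact: rs.
rewrite -(fsbig_widen [set` s])//= => [|l [_ /negP]]; last first.
  rewrite mem_undup mem_cat negb_or => /andP[/negPf l1 /negPf l2] /=.
  by rewrite coefE l1 l2 mulr0 subr0 mulr0.
rewrite -fsbig_seq ?undup_uniq//.
transitivity (\sum_(l <- s) N l * (l \in r1)%:R -
    p%:C * \sum_(l <- s) N l * (l \in r2)%:R).
  rewrite mulr_sumr -sumrB; apply: eq_bigr => l _.
  by rewrite coefE mulrBr mulrCA.
rewrite !sum_s// => [|l l2|l l1]; try by rewrite mem_undup mem_cat ?l1 ?l2 ?orbT.
have iotaE k (F : nat -> C) : \sum_(b <- iota 0 k) F b = \sum_(b < k) F b.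
  by rewrite -[iota 0 k](congr1 (iota 0) (subn0 k)) big_mkord.
by rewrite !big_map !iotaE.
Qed.

Lemma two_row_sumC w i j : two_row_sum w i j = two_row_sum w j i.
Proof. by rewrite /two_row_sum minnC addnC. Qed.

(** Two coefficients of the same degree differ by the partitions that enter
    when the smaller exponent grows: (i, j+1) through its Schur polynomial
    s_(i,j+1), and (i, j) through - p s_(i,j+1). *)
Lemma two_row_sumS w i j : (j < i)%N ->
  two_row_sum w i j.+1 = two_row_sum w i.+1 j + (w i j.+1 - p%:C * w i j).
Proof.
move=> ji; rewrite /two_row_sum (minn_idPr ji) (minn_idPr _); last by lia.
rewrite addSnnS big_ord_recr [X in _ - _ * X]big_ord_recr/= !addnK; ring.
Qed.

(** The solution of the triangular system for the numbers
    M_2(a,b) / G_(a,b)(1,1). *)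
Fixpoint pair_weight (A : comRingType) (q : A) (c : nat -> A) (a b : nat) : A :=
  if b is b'.+1 then q * pair_weight q c a b' + (c a * c b - c a.+1 * c b')
  else c a * c 0%N.

Lemma pair_weight_morph (A B : comRingType) (h : {rmorphism A -> B}) q c a b :
  pair_weight (h q) (h \o c) a b = h (pair_weight q c a b).
Proof.
elim: b => [|b IHb] /=; first by rewrite rmorphM.
by rewrite IHb !rmorphD rmorphN !rmorphM.
Qed.

(** Existence and uniqueness of the expansion of Phi(x) Phi(y): by
    [two_row_sumS] the equations along an antidiagonal are equivalent to the
    recursion. *)
Lemma two_row_sum_pair_weight w (c : nat -> C) :
  (forall i j, two_row_sum w i j = c i * c j) <->
  (forall a b, (b <= a)%N -> w a b = pair_weight p%:C c a b).
Proof.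
have column0 i : two_row_sum w i 0 = w i 0%N.
  rewrite /two_row_sum minn0 big_ord0 mulr0 subr0 big_ord_recl big_ord0.
  by rewrite addr0 addn0 subn0.
split=> [H a|H i j].
  elim=> [_|b IHb ba]; first by rewrite -column0 H.
  have := two_row_sumS w ba; rewrite !H IHb ?(ltnW ba)//= => ->; ring.
wlog ji : i j / (j <= i)%N.
  by move=> wl; have [/wl//|/ltnW/wl] := leqP j i; rewrite two_row_sumC mulrC.
elim: j i ji => [|j IHj] i ji; first by rewrite column0 H.
by rewrite two_row_sumS// IHj ?(leqW (ltnW ji))// !H// ?(ltnW ji)//=; ring.
Qed.

(** The assumption p < 1 makes G_(a,b)(1,1) nonzero, so that it can be divided
    out. *)
Lemma Mnum2 (hp : p < 1) (f : disk R -> C) a b : (b <= a)%N ->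
  Mnum p f (pair_part a b) = ((a - b).+1%:R - p * (a - b)%:R)%:C *
    pair_weight p%:C (taylor_coef f) a b.
Proof.
have expE (M : part 2 -> C) : is_expansion p f M <-> forall a b, (b <= a)%N ->
    M (pair_part a b) / groth1 p (pair_part a b) =
    pair_weight p%:C (taylor_coef f) a b.
  rewrite -(two_row_sum_pair_weight (fun a b =>
    M (pair_part a b) / groth1 p (pair_part a b))).
  have sumE (m : multinom 2) :
      \sum_(l \in [set: part 2]) (M l * (mcoeff m (groth p l) / groth1 p l)) =
      two_row_sum (fun a b => M (pair_part a b) / groth1 p (pair_part a b))
        (m ord0) (m ord_max).
    rewrite -(sum_part2 (fun l => M l / groth1 p l)).
    by apply: eq_fsbigr => l _; rewrite mulrA mulrAC.
  have prodE (m : multinom 2) : \prod_(i < 2) taylor_coef f (m i) =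
      taylor_coef f (m ord0) * taylor_coef f (m ord_max).
    rewrite !big_ord_recl big_ord0 mulr1; congr (_ * taylor_coef f (m _)).
    exact/val_inj.
  split=> [fM i j|H m]; last by rewrite sumE prodE H.
  have := fM (Multinom [tuple (if k == ord0 then i else j) | k < 2]).
  by rewrite sumE prodE !mnmE.
have g0 (l : part 2) : groth1 p l != 0 :> C.
  rewrite groth1_part2; set d := (_ - _)%N; rewrite fmorph_eq0 gt_eqF//.
  by rewrite -natr1 addrAC -{1}[d%:R]mul1r -mulrBl ltr_wpDl// mulr_ge0// subr_ge0 ltW.
move=> ba.
have gE : groth1 p (pair_part a b) = ((a - b).+1%:R - p * (a - b)%:R)%:C.
  by rewrite groth1_part2 pair_part0 pair_part1 (maxn_idPl ba) (minn_idPr ba).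
have : is_expansion p f (@Mnum R p f 2).
  apply: (@xgetPex _ (fun=> 0) [set M : part 2 -> C | is_expansion p f M]).
  exists (fun l => groth1 p l * pair_weight p%:C (taylor_coef f)
    (part_nth l ord0) (part_nth l ord_max)).
  apply/expE => i j ji; rewrite mulrC mulKf// pair_part0 pair_part1.
  by rewrite (maxn_idPl ji) (minn_idPr ji).
by move=> /expE/(_ _ _ ba); rewrite gE => <-; rewrite mulrC divfK// -gE.
Qed.

End Groth.

(** * Integrals that evaluate at a point *)

Section MeanAt.
Context d (T : measurableType d) (R : realType).
Variables (nu : probability T R) (x : T).
Implicit Types (f g h : T -> R) (c : R).

Definition bounded_mfun h :=
  measurable_fun [set: T] h /\ exists B, forall t, `|h t| <= B.

(** Boundedness is part of the definition because it makes the functions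
    integrable, hence the class stable under linear combinations. *)
Definition mean_at h := bounded_mfun h /\ \int[nu]_t h t = h x.

Lemma bounded_mfun_integrable h :
  bounded_mfun h -> nu.-integrable [set: T] (EFin \o h).
Proof.
move=> [mh [B hB]]; apply: measurable_bounded_integrable => //.
  exact: le_lt_trans (probability_le1 nu measurableT) (ltry 1).
exists B; split; first exact: num_real.
by move=> M BM t _; exact: le_trans (hB t) (ltW BM).
Qed.

Lemma bounded_mfun_cst c : bounded_mfun (fun=> c).
Proof. by split; [exact: measurable_cst|exists `|c|]. Qed.

Lemma bounded_mfunD f g : bounded_mfun f -> bounded_mfun g ->
  bounded_mfun (fun t => f t + g t).
Proof.
move=> [mf [B fB]] [mg [C gC]]; split; first exact: measurable_funD.
by exists (B + C) => t; apply: le_trans (ler_normD _ _) (lerD _ _).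
Qed.

Lemma bounded_mfunM f g : bounded_mfun f -> bounded_mfun g ->
  bounded_mfun (fun t => f t * g t).
Proof.
move=> [mf [B fB]] [mg [C gC]]; split; first exact: measurable_funM.
by exists (B * C) => t; rewrite normrM ler_pM.
Qed.

Lemma mean_at_cst c : mean_at (fun=> c).
Proof.
split; first exact: bounded_mfun_cst.
rewrite Rintegral_cst// -[RHS]mulr1; congr (_ * _).
by rewrite -[RHS]/(fine 1%E); congr fine; exact: probability_setT.
Qed.

Lemma mean_atD f g : mean_at f -> mean_at g -> mean_at (fun t => f t + g t).
Proof.
move=> [bf If] [bg Ig]; split; first exact: bounded_mfunD.
by rewrite RintegralD ?If ?Ig//; exact: bounded_mfun_integrable.
Qed.

Lemma mean_atZ c f : mean_at f -> mean_at (fun t => c * f t).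
Proof.
move=> [bf If]; split.
  by apply: bounded_mfunM => //; exact: bounded_mfun_cst.
by rewrite RintegralZl ?If//; exact: bounded_mfun_integrable.
Qed.

(** The function (f - f x)^2 is a linear combination of 1, f and f^2, so its
    integral is its value at x, which is 0. *)
Lemma mean_at_ae_cst f : mean_at f -> mean_at (fun t => f t * f t) ->
  nu.-negligible [set t | f t <> f x].
Proof.
move=> mf mff; pose h t := (f t - f x) ^+ 2.
have hE : h = (fun t => f t * f t + (- (2 * f x) * f t + f x * f x)).
  by apply/funext => t; rewrite /h; ring.
have [bh Ih] : mean_at h.
  rewrite hE; apply: mean_atD => //; apply: mean_atD; last exact: mean_at_cst.
  exact: mean_atZ.
have ih := bounded_mfun_integrable bh.
have h0 t : 0 <= h t by rewrite /h sqr_ge0.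
have : (\int[nu]_t `|(EFin \o h) t| = 0)%E.
  under eq_integral do rewrite /= ger0_norm//.
  have := integrable_fin_num measurableT ih => /fineK <-.
  by rewrite -[fine _]/(\int[nu]_t h t) Ih /h subrr expr0n.
move=> /(ae_eq_integral_abs _ measurableT); case.
  by apply/measurable_EFinP; exact: bh.1.
move=> N [mN N0 subN]; exists N; split=> // t /= ft; apply: subN => /= hN.
have /eqP : h t = 0 by apply: EFin_inj; exact: hN.
by rewrite /h sqrf_eq0 subr_eq0 => /eqP.
Qed.

Lemma dirac_of_negligible : nu.-negligible [set t | t <> x] ->
  forall A, measurable A -> nu A = \d_x A.
Proof.
move=> nx A mA; have null B : measurable B -> ~ B x -> nu B = 0%E.
  move=> mB Bx; apply: measure_negligible => //.
  by apply: negligibleS nx => t Bt tx; apply: Bx; rewrite -tx.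
rewrite diracE; have [/set_mem Ax|/negP Ax] := boolP (x \in A); last first.
  by apply: null => // Ax'; apply: Ax; exact: mem_set.
have : nu (~` A) = 0%E by apply: null; [exact: measurableC|exact].
move=> /(congr1 (fun y => 1 - y)%E); rewrite -probability_setC//.
  by rewrite setCK sube0.
exact: measurableC.
Qed.

End MeanAt.

(** * Vanishing variance of the Taylor coefficients *)

Section Rigidity.
Variables (R : realType) (p : R) (hp : 0 <= p < 1).
Variables (nu : probability (Fborel p) R) (Psi : Fborel p).
Hypothesis hM : forall (n : nat) (l : part n),
  Mnum p (Ffun Psi) l =
  Cintegral nu (fun Phi : Fborel p => Mnum p (Ffun Phi) l).

Lemma bounded_coef k : bounded_mfun (fun Phi : Fborel p => tcoef Phi k).
Proof.
split; first exact: tcoef_measurable.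
exists 1 => Phi; have /andP[c0 c1] := tcoef01 Phi k.
by rewrite ger0_norm.
Qed.

Lemma bounded_pair_weight a b :
  bounded_mfun (fun Phi : Fborel p => pair_weight p (tcoef Phi) a b).
Proof.
elim: b => [|b IHb] /=; first by apply: bounded_mfunM; exact: bounded_coef.
apply: bounded_mfunD; first by apply: bounded_mfunM => //; exact: bounded_mfun_cst.
apply: bounded_mfunD; first by apply: bounded_mfunM; exact: bounded_coef.
have -> : (fun Phi : Fborel p => - (tcoef Phi a.+1 * tcoef Phi b)) =
    (fun Phi => (-1) * (tcoef Phi a.+1 * tcoef Phi b)).
  by apply/funext => Phi; rewrite mulN1r.
apply: bounded_mfunM; first exact: bounded_mfun_cst.
by apply: bounded_mfunM; exact: bounded_coef.
Qed.

Lemma mean_at_Mnum n (l : part n) (h : Fborel p -> R) : bounded_mfun h ->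
  (forall Phi : Fborel p, Mnum p (Ffun Phi) l = (h Phi)%:C) ->
  mean_at nu Psi h.
Proof.
move=> bh Mh; split=> //; apply: esym.
have := congr1 (@complex.Re R) (hM l); rewrite Mh /= => ->.
by apply: eq_Rintegral => Phi _; rewrite Mh.
Qed.

Lemma mean_at_coef k : mean_at nu Psi (fun Phi => tcoef Phi k).
Proof.
apply: (@mean_at_Mnum 1 (part1 k)); first exact: bounded_coef.
by move=> Phi; rewrite Mnum1 taylor_coefE.
Qed.

(** The hypothesis at level 2, after division by G_(a,b)(1,1). *)
Lemma mean_at_pair_weight a b : (b <= a)%N ->
  mean_at nu Psi (fun Phi => pair_weight p (tcoef Phi) a b).
Proof.
move=> ba; have [p0 p1] := andP hp.
set u : R := (a - b).+1%:R - p * (a - b)%:R.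
have u0 : u != 0.
  rewrite gt_eqF// /u -natr1 addrAC -{1}[(a - b)%:R]mul1r -mulrBl.
  by rewrite ltr_wpDl// mulr_ge0// subr_ge0 ltW.
have : mean_at nu Psi (fun Phi => u * pair_weight p (tcoef Phi) a b).
  apply: (@mean_at_Mnum 2 (pair_part a b)).
    by apply: bounded_mfunM; [exact: bounded_mfun_cst|exact: bounded_pair_weight].
  move=> Phi; rewrite Mnum2// rmorphM; congr (_ * _).
  rewrite -pair_weight_morph; congr (pair_weight _ _ _ _).
  by apply/funext => k /=; rewrite taylor_coefE.
move=> /(mean_atZ u^-1); congr (mean_at _ _ _).
by apply/funext => Phi; rewrite mulKf.
Qed.

(** Solving the recursion of [pair_weight] for the product:
    c_a c_(b+1) = c_(a+1) c_b + m_(a,b+1) - p m_(a,b), which lowers the smaller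
    index at constant degree. *)
Lemma mean_at_coefM a b : (b <= a)%N ->
  mean_at nu Psi (fun Phi => tcoef Phi a * tcoef Phi b).
Proof.
elim: b a => [|b IHb] a ba; first exact: (mean_at_pair_weight ba).
have -> : (fun Phi : Fborel p => tcoef Phi a * tcoef Phi b.+1) = (fun Phi =>
    tcoef Phi a.+1 * tcoef Phi b + (pair_weight p (tcoef Phi) a b.+1 +
      - p * pair_weight p (tcoef Phi) a b)).
  by apply/funext => Phi /=; ring.
apply: mean_atD; first by apply: IHb; rewrite leqW// ltnW.
apply: mean_atD; first exact: mean_at_pair_weight.
by apply/mean_atZ/mean_at_pair_weight/ltnW.
Qed.

Lemma ae_eq_Psi : nu.-negligible [set Phi | Phi <> Psi].
Proof.
have : nu.-negligible (\bigcup_k [set Phi | tcoef Phi k <> tcoef Psi k]).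
  apply: negligible_bigcup => k; apply: mean_at_ae_cst; first exact: mean_at_coef.
  exact: mean_at_coefM.
apply: negligibleS => Phi neq; apply: contrapT => same.
apply: neq; apply: tcoef_inj => k; apply: contrapT => neqk.
by apply: same; exists k.
Qed.

End Rigidity.

Theorem theorem3p18 (R : realType) (p : R) (hp : 0 <= p < 1)
    (nu : probability (Fborel p) R) (Psi : Fborel p)
    (hM : forall (n : nat) (l : part n),
       Mnum p (Ffun Psi) l =
       Cintegral nu (fun Phi : Fborel p => Mnum p (Ffun Phi) l)) :
  forall A : set (Fborel p), measurable A -> nu A = \d_Psi A.
Proof. exact: dirac_of_negligible (ae_eq_Psi hp hM). Qed.
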